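(* Let $I$ be either a finite interval $[a,b]$ with $a+b=1$ or $I=(-\infty,+\infty)$, let $w$ be a weight function on $I$ with $w(x)\equiv w(1-x)$, and let $\{P_n\}_{n\ge0}$ be the normalized orthogonal polynomials in $L^2_w(I)$, satisfying $$P_n(1-x)=(-1)^nP_n(x),\qquad n=0,1,2,\dots$$ Let $\bar A_{\tau,\sigma},\bar B_\tau,B_\tau,C_\tau$ ($\tau,\sigma\in I$) be the coefficients of a continuous-stage Runge-Kutta-Nyström method with $C_\tau=\tau$, $\bar B_\tau=B_\tau(1-C_\tau)$ and $\bar A_{\tau,\sigma}/B_\sigma\in L^2_w(I\times I)$. Then the symmetric condition $$\begin{aligned}C_\tau&=1-C_{1-\tau},\\ \bar A_{\tau,\sigma}w(\sigma)&=\big(B_{1-\sigma}(1-C_{1-\tau})-\bar B_{1-\sigma}+\bar A_{1-\tau,1-\sigma}\big)w(1-\sigma),\\ \bar B_\tau w(\tau)&=(B_{1-\tau}-\bar B_{1-\tau})w(1-\tau),\\ B_\tau w(\tau)&=B_{1-\tau}w(1-\tau),\end{aligned}\qquad\text{for all }\tau,\sigma\in I,$$ is equivalent to the fact that $B_\sigma\equiv B_{1-\sigma}$ and $\bar A_{\tau,\sigma}$ has the form $$\bar A_{\tau,\sigma}=B_\sigma\Big(\alpha_{(0,0)}+\alpha_{(0,1)}P_1(\sigma)+\alpha_{(1,0)}P_1(\tau)+\sum_{\substack{i+j\text{ even}\\ i+j>1}}\alpha_{(i,j)}P_i(\tau)P_j(\sigma)\Big),\quad \alpha_{(i,j)}\in\mathbb{R},$$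 where $\alpha_{(0,1)}=-\alpha_{(1,0)}=-\tfrac12\langle x,P_1(x)\rangle_w$.
   Context: A non-negative function $w$ on $I$ is a weight function if all moments $\int_I x^kw(x)\,dx$, $k\in\mathbb{N}$, exist, and for any non-negative function $u$, $\int_I u w\,dx=0$ implies $u\equiv0$. $L^2_w(I)$ is the Hilbert space with inner product $\langle u,v\rangle_w=\int_Iu(x)v(x)w(x)\,dx$; $L^2_w(I\times I)$ is the corresponding space of two-variable functions with weight $w(\tau)w(\sigma)$. $\{P_n\}_{n\ge0}$ are the orthogonal polynomials ($\deg P_n=n$) with $\langle P_i,P_j\rangle_w=\delta_{ij}$, assumed to be a complete set in $L^2_w(I)$. Indices $i,j$ range over non-negative integers and the series is the expansion in $L^2_w(I\times I)$ with respect to $\{P_i(\tau)P_j(\sigma)\}$. Writing the quotient $\bar A_{\tau,\sigma}/B_\sigma$ presupposes that it is defined. A continuous-stage Runge-Kutta-Nyström method for $q''=f(t,q)$, $q(t_0)=q_0$, $q'(t_0)=q_0'$, with step size $h$, is $$Q_\tau=q_0+hC_\tau q_0'+h^2\int_I\bar A_{\tau,\sigma}w(\sigma)f(t_0+C_\sigma h,Q_\sigma)\,d\sigma,\ \tau\in I,$$ $$q_1=q_0+hq_0'+h^2\int_I\bar B_\tau w(\tau)f(t_0+C_\tau h,Q_\tau)\,d\tau,\qquad q_1'=q_0'+h\int_IB_\tau w(\tau)f(t_0+C_\tau h,Q_\tau)\,d\tau.$$ *)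

(* Defs.v *)
From HB Require Import structures.
From mathcomp Require Import all_boot all_order all_algebra finmap.
From mathcomp Require Import all_classical all_reals all_analysis.
From mathcomp Require Export summability.
Set Implicit Arguments.
Unset Strict Implicit.
Unset Printing Implicit Defensive.
Import Order.TTheory GRing.Theory Num.Theory.
Import numFieldNormedType.Exports.
Local Open Scope classical_set_scope.
Local Open Scope ring_scope.

(* Convention: functions on I (resp. I x I) are elements of weighted L^2
   spaces, so an identity between such functions is equality almost everywhere
   for Lebesgue measure on I (resp. I x I).  An L^2 expansion determines its sum
   only up to a null set, and a weight may vanish at some points of I. *)

Notation leb R := (@lebesgue_measure R).
Notation leb2 R := ((@lebesgue_measure R) \x (@lebesgue_measure R))%E.

Definition symmetric_domain (R : realType) (I : set R) : Prop :=
  (exists a b : R, [/\ a < b, a + b = 1 & I = `[a, b]%classic]) \/ I = setT.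

(* As usual for integrals, [u] vanishes identically means: almost everywhere. *)
Definition weight_function (R : realType) (I : set R) (w : R -> R) : Prop :=
  [/\ forall x, I x -> 0 <= w x,
      forall k : nat, (leb R).-integrable I (fun x => (x ^+ k * w x)%:E)
    & forall u : R -> R, measurable_fun I u -> (forall x, I x -> 0 <= u x) ->
        (\int[leb R]_(x in I) (u x * w x)%:E = 0)%E ->
        u = cst 0 %[ae leb R in I]].

Definition inner (R : realType) (I : set R) (w u v : R -> R) : R :=
  (\int[leb R]_(x in I) (u x * v x * w x))%R.

Definition in_L2w d (T : measurableType d) (R : realType)
    (mu : set T -> \bar R) (D : set T) (w u : T -> R) : Prop :=
  measurable_fun D u /\ mu.-integrable D (fun x => (u x ^+ 2 * w x)%:E).

Definition sq_dist d (T : measurableType d) (R : realType)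
    (mu : set T -> \bar R) (D : set T) (w u v : T -> R) : \bar R :=
  (\int[mu]_(x in D) ((u x - v x) ^+ 2 * w x)%:E)%E.

Definition weight2 (R : realType) (w : R -> R) (z : R * R) : R := w z.1 * w z.2.

Definition orthonormal_polynomials (R : realType) (I : set R) (w : R -> R)
    (P : nat -> {poly R}) : Prop :=
  (forall n, size (P n) = n.+1) /\
  (forall i j, inner I w (horner (P i)) (horner (P j)) = (i == j)%:R).

(* The linear span of the P_n is dense in L^2_w(I). *)
Definition complete_polynomials (R : realType) (I : set R) (w : R -> R)
    (P : nat -> {poly R}) : Prop :=
  forall u : R -> R, in_L2w (leb R) I w u ->
  forall e : R, 0 < e ->
  exists (n : nat) (c : nat -> R),
    (sq_dist (leb R) I w u (fun x => (\sum_(i < n) c i * (P i).[x])%R) < e%:E)%E.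

(* S is the sum in L^2_w(I x I) of the terms alpha_(i,j) P_i(tau) P_j(sigma)
   over the index pairs satisfying K: the finite partial sums converge along the
   directed set of finite sets of pairs, i.e. independently of the order. *)
Definition L2w_double_sum (R : realType) (I : set R) (w : R -> R)
    (P : nat -> {poly R}) (K : pred (nat * nat)) (alpha : nat * nat -> R)
    (S : R * R -> R) : Prop :=
  in_L2w (leb2 R) (I `*` I) (weight2 w) S /\
  sq_dist (leb2 R) (I `*` I) (weight2 w) S
    (fun z => \sum_(ij <- F | K ij)
       alpha ij * (P ij.1).[z.1] * (P ij.2).[z.2])
    @[F --> totally] --> (0 : \bar R).

(* Coefficients of the method, for a step of size h from (t0, q0, q0'):
     Q_tau = q0 + h C_tau q0'
             + h^2 int_I Abar_(tau,sigma) w(sigma) f(t0 + C_sigma h, Q_sigma) dsigma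
     q1  = q0 + h q0' + h^2 int_I Bbar_tau w(tau) f(t0 + C_tau h, Q_tau) dtau
     q1' = q0' + h int_I B_tau w(tau) f(t0 + C_tau h, Q_tau) dtau.
   Only values at arguments in I matter. *)
Record csRKN (R : realType) := CsRKN {
  Abar : R -> R -> R;
  Bbar : R -> R;
  Bcoef : R -> R;
  Ccoef : R -> R
}.

Definition symmetric_condition (R : realType) (I : set R) (w : R -> R)
    (M : csRKN R) : Prop :=
  let A := Abar M in let Bb := Bbar M in let B := Bcoef M in let C := Ccoef M in
  [/\ C = (fun t => 1 - C (1 - t)) %[ae leb R in I],
      (fun z => A z.1 z.2 * w z.2) =
        (fun z => (B (1 - z.2) * (1 - C (1 - z.1)) - Bb (1 - z.2)
                   + A (1 - z.1) (1 - z.2)) * w (1 - z.2))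
        %[ae leb2 R in I `*` I],
      (fun t => Bb t * w t) = (fun t => (B (1 - t) - Bb (1 - t)) * w (1 - t))
        %[ae leb R in I]
    & (fun t => B t * w t) = (fun t => B (1 - t) * w (1 - t))
        %[ae leb R in I]].

(* Main.v *)
Require Import Defs.
From HB Require Import structures.
From mathcomp Require Import all_boot all_order all_algebra finmap.
From mathcomp Require Import all_classical all_reals all_analysis.
From mathcomp Require Import measurable_realfun ring lra.
Import Order.TTheory GRing.Theory Num.Theory.
Import numFieldNormedType.Exports.
Local Open Scope classical_set_scope.
Local Open Scope ring_scope.

Set Implicit Arguments.
Unset Strict Implicit.
Unset Printing Implicit Defensive.

(** Divide the second symmetry identity by [B(sigma) w(sigma)], which is nonzero
almost everywhere. With [C = id] and [Bbar = B (1 - C)] it says that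
[G = Abar / B] satisfies
[G(tau, sigma) = (tau - sigma) + G(1 - tau, 1 - sigma)], that is, that
[H = G - (tau - sigma) / 2] is invariant under
[rho : (tau, sigma) |-> (1 - tau, 1 - sigma)]; the other identities reduce to
[B(sigma) = B(1 - sigma)] ([symmetric_conditionP]). Since [P_1] is odd about
[1/2], [x - 1/2 = <x, P_1> P_1(x)] ([poly1E]), so [(tau - sigma) / 2] is exactly
the pair of terms of the expansion with coefficients [alpha_(1,0)] and
[alpha_(0,1)]. It remains to show that [H] is invariant under [rho] if and only
if it is a constant plus an [L^2] sum of terms [P_i(tau) P_j(sigma)] with [i + j]
even and positive.

The reflection [rho] preserves the measure and multiplies [P_i P_j] by
[(-1)^(i+j)]. If [H] is invariant, its coefficients with [i + j] odd are
therefore equal to their opposites ([kernel_coef_odd]), and the series of [H] has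
only even terms. Conversely the finite sums of even terms are invariant, and so
is their limit ([L2w_double_sum_symmetric]).

That the series of [H] converges to [H] is the completeness of the products
[P_i P_j], deduced from that of the [P_n] by applying Parseval's identity twice,
once in each variable, under Tonelli's theorem ([parseval_slice],
[parseval_tensor]). All this takes place in unweighted [L^2] spaces over the
whole line and plane, into which multiplication by the square root of the weight
followed by extension by zero ([unweight]) is an isometry. *)

(** * Square-integrable functions and orthonormal families *)

Section almost_everywhere.
Context {d : measure_display} {T : measurableType d} {R : realType}.
Variable mu : {measure set T -> \bar R}.

Lemma aeS (P Q : T -> Prop) : (forall x, P x -> Q x) ->
  {ae mu, forall x, P x} -> {ae mu, forall x, Q x}.
Proof. by move=> PQ; apply: filterS. Qed.

Lemma aeI (P Q : T -> Prop) :
  {ae mu, forall x, P x} -> {ae mu, forall x, Q x} ->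
  {ae mu, forall x, P x /\ Q x}.
Proof. by apply: filterS2. Qed.

End almost_everywhere.

Section square_integrable.
Context {d : measure_display} {T : measurableType d} {R : realType}.
Variable mu : {measure set T -> \bar R}.
Implicit Types f g h : T -> R.

Definition L2 f := measurable_fun setT f /\
  mu.-integrable setT (fun x => (f x ^+ 2)%:E).

Definition ip f g : R := \int[mu]_x (f x * g x).

Lemma L2_integrableM f g : L2 f -> L2 g ->
  mu.-integrable setT (fun x => (f x * g x)%:E).
Proof.
move=> [mf f2] [mg g2].
have := integrableD measurableT f2 g2; apply: le_integrable => //.
  exact/measurable_EFinP/measurable_funM.
move=> x _ /=; rewrite lee_fin [leRHS]ger0_norm ?addr_ge0 ?sqr_ge0//.
by rewrite ler_norml; apply/andP; split; nra.
Qed.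

Lemma L2D f g : L2 f -> L2 g -> L2 (fun x => f x + g x).
Proof.
move=> Lf Lg; have [mf f2] := Lf; have [mg g2] := Lg.
split; first exact: measurable_funD.
have h := integrableD measurableT (integrableD measurableT f2 g2)
  (integrableZl measurableT 2 (L2_integrableM Lf Lg)).
apply: eq_integrable h => //= x _.
by rewrite -!EFinM -!EFinD; congr EFin; ring.
Qed.

Lemma L2Z (c : R) f : L2 f -> L2 (fun x => c * f x).
Proof.
move=> [mf f2]; split; first exact: measurable_funM.
apply: eq_integrable (integrableZl measurableT (c ^+ 2) f2) => //= x _.
by rewrite -EFinM exprMn.
Qed.

Lemma L2B f g : L2 f -> L2 g -> L2 (fun x => f x - g x).
Proof.
move=> Lf Lg; rewrite (_ : (fun x => _) = (fun x => f x + (-1) * g x)).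
  exact: L2D Lf (L2Z _ Lg).
by apply/funext => x; rewrite mulN1r.
Qed.

Lemma L20 : L2 (fun=> 0).
Proof.
split; first exact: measurable_cst.
by under eq_fun do rewrite expr0n/=; exact: integrable0.
Qed.

Lemma L2_sum (K : Type) (s : seq K) (e : K -> T -> R) :
  (forall k, L2 (e k)) -> L2 (fun x => \sum_(k <- s) e k x).
Proof.
move=> Le; elim: s => [|k s IH].
  by under eq_fun do rewrite big_nil; exact: L20.
by under eq_fun do rewrite big_cons; exact: L2D.
Qed.

Lemma L2_ae_eq f g : measurable_fun setT g -> f = g %[ae mu] -> L2 f -> L2 g.
Proof.
move=> mg fg [mf f2]; split => //; apply/integrableP; split.
  by apply/measurable_EFinP; exact: measurable_funX.
move/integrableP : f2 => [_]; congr (_ < _)%E; apply: ae_eq_integral => //.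
- by apply: measurableT_comp => //; apply/measurable_EFinP; exact: measurable_funX.
- by apply: measurableT_comp => //; apply/measurable_EFinP; exact: measurable_funX.
- by apply: filterS fg => x /(_ Logic.I) ->.
Qed.

Lemma ipC f g : ip f g = ip g f.
Proof. by rewrite /ip; under eq_Rintegral do rewrite mulrC. Qed.

Lemma ipDl f g h : L2 f -> L2 g -> L2 h ->
  ip (fun x => f x + g x) h = ip f h + ip g h.
Proof.
move=> Lf Lg Lh; rewrite /ip -RintegralD//; try exact: L2_integrableM.
by under eq_Rintegral do rewrite mulrDl.
Qed.

Lemma ipZl c f h : L2 f -> L2 h -> ip (fun x => c * f x) h = c * ip f h.
Proof.
move=> Lf Lh; rewrite /ip -RintegralZl//; last exact: L2_integrableM.
by under eq_Rintegral do rewrite -mulrA.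
Qed.

Lemma ipBl f g h : L2 f -> L2 g -> L2 h ->
  ip (fun x => f x - g x) h = ip f h - ip g h.
Proof.
move=> Lf Lg Lh; rewrite /ip -RintegralB//; try exact: L2_integrableM.
by under eq_Rintegral do rewrite mulrBl.
Qed.

Lemma ip_suml (K : Type) (s : seq K) (e : K -> T -> R) h :
  (forall k, L2 (e k)) -> L2 h ->
  ip (fun x => \sum_(k <- s) e k x) h = \sum_(k <- s) ip (e k) h.
Proof.
move=> Le Lh; elim: s => [|k s IH].
  rewrite big_nil /ip; under eq_Rintegral do rewrite big_nil mul0r.
  by rewrite Rintegral_cst// mul0r.
rewrite big_cons -IH -ipDl//; last exact: L2_sum.
by congr ip; apply/funext => x; rewrite big_cons.
Qed.

Lemma ip_ge0 f : 0 <= ip f f.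
Proof. by apply: Rintegral_ge0 => x _; rewrite -expr2 sqr_ge0. Qed.

Lemma ip_EFin f g : L2 f -> L2 g ->
  (ip f g)%:E = (\int[mu]_x (f x * g x)%:E)%E.
Proof.
by move=> Lf Lg; rewrite fineK//; apply: integrable_fin_num => //; exact: L2_integrableM.
Qed.

Lemma eq_ip f f' g g' : L2 f -> L2 g -> L2 f' -> L2 g' ->
  f = f' %[ae mu] -> g = g' %[ae mu] -> ip f g = ip f' g'.
Proof.
move=> Lf Lg Lf' Lg' ff' gg'; congr fine; apply: ae_eq_integral => //.
- exact: measurable_int (L2_integrableM Lf Lg).
- exact: measurable_int (L2_integrableM Lf' Lg').
- by apply: filterS2 ff' gg' => x /(_ Logic.I) -> /(_ Logic.I) ->.
Qed.

Definition orthonormal_family {K : eqType} (e : K -> T -> R) :=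
  (forall k, L2 (e k)) /\ (forall k l, ip (e k) (e l) = (k == l)%:R).

Lemma ip_comb {K : eqType} (e : K -> T -> R) (s : seq K) (c : K -> R) k :
  orthonormal_family e -> uniq s ->
  ip (fun x => \sum_(l <- s) c l * e l x) (e k) = (k \in s)%:R * c k.
Proof.
move=> [Le eo] us; rewrite (ip_suml s (e := fun l x => c l * e l x))//; last first.
  by move=> l; exact: L2Z.
under eq_bigr do rewrite ipZl// eo.
have [ks|ks] := boolP (k \in s).
  rewrite (bigD1_seq k)//= eqxx mulr1 mul1r big1 ?addr0// => l.
  by move=> /negPf ->; rewrite mulr0.
rewrite mul0r big_seq big1// => l ls.
by case: eqP ls ks => [->|]; rewrite ?mulr0// => ->.
Qed.

(** Completing the square: the [c]-dependence is isolated in the last sum, so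
the Fourier coefficients [ip f (e k)] give the best approximation. *)
Lemma ip_subcomb {K : eqType} (e : K -> T -> R) (s : seq K) (c : K -> R) f
    (g := fun x => f x - \sum_(k <- s) c k * e k x) :
  orthonormal_family e -> uniq s -> L2 f ->
  ip g g = ip f f - \sum_(k <- s) ip f (e k) ^+ 2
           + \sum_(k <- s) (c k - ip f (e k)) ^+ 2.
Proof.
move=> oe us Lf; have [Le _] := oe.
pose p x := \sum_(k <- s) c k * e k x.
have Lce k : L2 (fun x => c k * e k x) by exact: L2Z.
have Lp : L2 p by exact: L2_sum Lce.
have Lg : L2 g by exact: L2B.
have iph h : L2 h -> ip p h = \sum_(k <- s) c k * ip h (e k).
  move=> Lh; rewrite (ip_suml s (e := fun l x => c l * e l x))//.
  by apply: eq_bigr => k _; rewrite ipZl// [ip h _]ipC.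
have ipp : ip p p = \sum_(k <- s) c k ^+ 2.
  rewrite iph// big_seq [RHS]big_seq; apply: eq_bigr => k ks.
  by rewrite ip_comb// ks mul1r expr2.
rewrite ipBl// [ip f g]ipC [ip _ g]ipC !ipBl// ipp iph// [ip f p]ipC iph//.
have -> : \sum_(k <- s) (c k - ip f (e k)) ^+ 2 = \sum_(k <- s) c k ^+ 2
    - 2 * \sum_(k <- s) c k * ip f (e k) + \sum_(k <- s) ip f (e k) ^+ 2.
  rewrite mulr_sumr -sumrB -big_split/=.
  by apply: eq_bigr => k _; ring.
by ring.
Qed.

Lemma bessel {K : eqType} (e : K -> T -> R) (s : seq K) f :
  orthonormal_family e -> uniq s -> L2 f ->
  \sum_(k <- s) ip f (e k) ^+ 2 <= ip f f.
Proof.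
move=> oe us Lf; rewrite -subr_ge0.
have := ip_subcomb (fun k => ip f (e k)) oe us Lf.
rewrite [X in _ + X]big1 ?addr0; first by move=> <-; exact: ip_ge0.
by move=> k _; rewrite subrr expr0n.
Qed.

Lemma ip_sub_le f g : L2 f -> L2 g ->
  ip (fun x => f x - g x) (fun x => f x - g x) <= 2 * ip f f + 2 * ip g g.
Proof.
move=> Lf Lg; have LD := L2D Lf Lg; have LB := L2B Lf Lg.
have fgE : ip (fun x => f x + g x) (fun x => f x + g x)
    = ip f f + 2 * ip f g + ip g g.
  by rewrite ipDl// ![ip _ (fun x => f x + g x)]ipC !ipDl// [ip g f]ipC; ring.
have -> : ip (fun x => f x - g x) (fun x => f x - g x)
    = ip f f - 2 * ip f g + ip g g.
  by rewrite ipBl// ![ip _ (fun x => f x - g x)]ipC !ipBl// [ip g f]ipC; ring.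
have := ip_ge0 (fun x => f x + g x); rewrite fgE; lra.
Qed.

Lemma ip_eq0 f : L2 f -> ip f f = 0 -> f = (fun=> 0) %[ae mu].
Proof.
move=> Lf f0; have [mf _] := Lf.
have : (\int[mu]_x `|(f x * f x)%:E| = 0)%E.
  rewrite -[RHS](congr1 EFin f0) ip_EFin//.
  by apply: eq_integral => x _; rewrite gee0_abs// lee_fin -expr2 sqr_ge0.
move=> /ae_eq_integral_abs-/(_ measurableT); case.
  exact/measurable_EFinP/measurable_funM.
move=> N HN; exists N; move: HN => [mN N0 sN]; split => // x nx.
apply: sN => /= h; apply: nx => _.
by have /eqP := h Logic.I; rewrite eqe -expr2 sqrf_eq0 => /eqP.
Qed.

End square_integrable.

(** * Parseval's identity for product families *)

Section parseval.
Context {d : measure_display} {T : measurableType d} {R : realType}.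
Variable mu : {measure set T -> \bar R}.
Implicit Types f g : T -> R.

(** Density of the span in the functions of [L2] supported in [D]; relative to
[D] because orthogonal polynomials on an interval are extended by zero. *)
Definition total_family (D : set T) (e : nat -> T -> R) := forall f, L2 mu f ->
  (forall x, ~ D x -> f x = 0) ->
  forall eps, 0 < eps -> exists (n : nat) (c : nat -> R),
  ip mu (fun x => f x - \sum_(0 <= i < n) c i * e i x)
        (fun x => f x - \sum_(0 <= i < n) c i * e i x) < eps.

(** Bessel gives one inequality. For the other, an approximating combination is
no closer to [f] than the Fourier sum with the same indices. *)
Lemma parseval (D : set T) (e : nat -> T -> R) f :
  orthonormal_family mu e -> total_family D e -> L2 mu f ->
  (forall x, ~ D x -> f x = 0) ->
  ((\sum_(i <oo) (ip mu f (e i) ^+ 2)%:E) = (ip mu f f)%:E)%E.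
Proof.
move=> oe te Lf f0; apply/eqP; rewrite eq_le; apply/andP; split.
  apply: lime_le; first by apply: is_cvg_nneseries => n _ _; rewrite lee_fin sqr_ge0.
  apply: nearW => n; rewrite sumEFin lee_fin.
  by apply: bessel => //; exact: iota_uniq.
apply/lee_addgt0Pr => eps eps0.
have [n [c lt_eps]] := te _ Lf f0 _ eps0.
rewrite ip_subcomb ?iota_uniq// in lt_eps.
have := nneseries_lim_ge (u_ := fun i => (ip mu f (e i) ^+ 2)%:E) (P := xpredT)
  (m := 0%N) n (fun i _ _ => ltac:(by rewrite lee_fin sqr_ge0)).
rewrite sumEFin => /(leeD2r eps%:E); apply: le_trans.
rewrite -EFinD lee_fin.
have : 0 <= \sum_(k <- index_iota 0 n) (c k - ip mu f (e k)) ^+ 2.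
  by apply: sumr_ge0 => k _; exact: sqr_ge0.
lra.
Qed.

End parseval.

Definition tensor {T : Type} {R : realType} (f g : T -> R) (z : T * T) : R :=
  f z.1 * g z.2.

Definition tensor_family {T : Type} {R : realType} (e : nat -> T -> R)
    (ij : nat * nat) :=
  tensor (e ij.1) (e ij.2).

Section tensor.
Context {d : measure_display} {T : measurableType d} {R : realType}.
Variable mu : {sigma_finite_measure set T -> \bar R}.
Let mu2 := (mu \x mu)%E.
Implicit Types (D : set T) (f g : T -> R) (F : T * T -> R).

Definition slice F g (x : T) : R := ip mu (fun y => F (x, y)) g.

Lemma measurable_tensor f g : measurable_fun setT f -> measurable_fun setT g ->
  measurable_fun setT (tensor f g).
Proof.
move=> mf mg; apply: measurable_funM.
- by apply: measurableT_comp mf _; exact: measurable_fst.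
- by apply: measurableT_comp mg _; exact: measurable_snd.
Qed.

Lemma L2_tensor f g : L2 mu f -> L2 mu g -> L2 mu2 (tensor f g).
Proof.
move=> Lf Lg; have [mf _] := Lf; have [mg _] := Lg.
split; first exact: measurable_tensor.
apply/integrable12ltyP.
  by apply/measurable_EFinP/measurable_funX; exact: measurable_tensor.
rewrite (_ : (fun x => _) = fun x => ((ip mu g g)%:E * (f x * f x)%:E)%E).
  rewrite ge0_integralZl//; first last.
  - by rewrite lee_fin ip_ge0.
  - by move=> x _; rewrite lee_fin -expr2 sqr_ge0.
  - by apply/measurable_EFinP/measurable_funM.
  by rewrite -ip_EFin// -EFinM ltry.
apply/funext => x; rewrite ip_EFin// muleC -ge0_integralZl//.
- apply: eq_integral => y _; rewrite gee0_abs ?lee_fin ?sqr_ge0// -EFinM.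
  by congr EFin; rewrite /tensor/=; ring.
- by apply/measurable_EFinP/measurable_funM.
- by move=> y _; rewrite lee_fin -expr2 sqr_ge0.
- by rewrite lee_fin -expr2 sqr_ge0.
Qed.

Lemma ae_L2_section F : L2 mu2 F -> {ae mu, forall x, L2 mu (fun y => F (x, y))}.
Proof.
move=> [mF F2]; have := ae_integrable1 F2; apply: filterS => x iF.
by split => //; exact: measurableT_comp mF (pair1_measurable x).
Qed.

(** Integrability of almost all sections only gives a value almost everywhere;
measurability everywhere comes from Tonelli on positive and negative parts. *)
Lemma measurable_slice F g : measurable_fun setT F -> measurable_fun setT g ->
  measurable_fun setT (slice F g).
Proof.
move=> mF mg; apply: (measurableT_comp (f := fine)) => //.
pose G z := (F z * g z.2)%:E.
have mG : measurable_fun setT G.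
  apply/measurable_EFinP/measurable_funM => //.
  by apply: measurableT_comp mg _; exact: measurable_snd.
rewrite (_ : (fun x => _) = fun x =>
    (\int[mu]_y G^\+ (x, y) - \int[mu]_y G^\- (x, y))%E); last first.
  apply/funext => x; rewrite [LHS]integralE.
  by congr (_ - _)%E; apply: eq_integral => y _; rewrite ?funeposE ?funenegE.
apply: emeasurable_funB.
- by apply: (measurable_fun_fubini_tonelli_F (G^\+)%E) => //; exact: measurable_funepos.
- by apply: (measurable_fun_fubini_tonelli_F (G^\-)%E) => //; exact: measurable_funeneg.
Qed.

Lemma ip_tensor F f g : L2 mu2 F -> L2 mu f -> L2 mu g ->
  ip mu2 F (tensor f g) = ip mu (slice F g) f.
Proof.
move=> LF Lf Lg; have iF := L2_integrableM LF (L2_tensor Lf Lg).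
have [mF _] := LF; have [mf _] := Lf; have [mg _] := Lg.
rewrite /ip /Rintegral -(integral12_prod_meas1 iF); congr fine.
apply: ae_eq_integral => //.
- exact: measurable_fubini_F iF.
- by apply/measurable_EFinP/measurable_funM => //; exact: measurable_slice.
- apply: filterS (ae_L2_section LF) => x Lx _.
  rewrite EFinM ip_EFin// muleC -integralZl//; last exact: L2_integrableM.
  by apply: eq_integral => y _; rewrite -EFinM /tensor/=; congr EFin; ring.
Qed.

Lemma ip_tensorM f g f' g' : L2 mu f -> L2 mu g -> L2 mu f' -> L2 mu g' ->
  ip mu2 (tensor f g) (tensor f' g') = ip mu f f' * ip mu g g'.
Proof.
move=> Lf Lg Lf' Lg'; rewrite ip_tensor//; last exact: L2_tensor.
rewrite mulrC -ipZl//; congr ip; apply/funext => x.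
by rewrite /slice /tensor/= ipZl// mulrC.
Qed.

Lemma orthonormal_tensor e : orthonormal_family mu e ->
  orthonormal_family mu2 (tensor_family e).
Proof.
move=> [Le oe]; split; first by move=> ij; exact: L2_tensor.
move=> [i j] [k l]; rewrite ip_tensorM// !oe xpair_eqE/= -natrM.
by rewrite mulnb.
Qed.

(** Tonelli and Parseval in the second variable, for almost every value of the
first. *)
Lemma parseval_slice D e F : orthonormal_family mu e -> total_family mu D e ->
  L2 mu2 F -> (forall z, ~ (D `*` D) z -> F z = 0) ->
  (forall j, L2 mu (slice F (e j))) /\
  ((\sum_(j <oo) (ip mu (slice F (e j)) (slice F (e j)))%:E)
    = (ip mu2 F F)%:E)%E.
Proof.
move=> oe te LF F0; have [mF _] := LF; have [Le _] := oe.
have mslice j : measurable_fun setT (slice F (e j)).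
  by apply: measurable_slice => //; have [] := Le j.
have m2 j : measurable_fun setT (fun x => (slice F (e j) x ^+ 2)%:E).
  exact/measurable_EFinP/measurable_funX.
have sumE : ((\sum_(j <oo) \int[mu]_x (slice F (e j) x ^+ 2)%:E)
    = (ip mu2 F F)%:E)%E.
  rewrite -integral_nneseries//; last first.
    by move=> j x _; rewrite lee_fin sqr_ge0.
  have mFF : measurable_fun setT (fun z => (F z * F z)%:E).
    exact/measurable_EFinP/measurable_funM.
  have FF0 z : (0 <= (F z * F z)%:E)%E by rewrite lee_fin -expr2 sqr_ge0.
  rewrite ip_EFin// fubini_tonelli1//.
  apply: ae_eq_integral => //.
  - apply: ge0_emeasurable_sum => // j x _ _; rewrite lee_fin sqr_ge0//.
  - exact: measurable_fun_fubini_tonelli_F.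
  apply: filterS (ae_L2_section LF) => x Lx _.
  rewrite (parseval oe te Lx) ?ip_EFin// => y Dy.
  by apply: F0 => -[].
have Ls j : L2 mu (slice F (e j)).
  split => //; apply/integrableP; split => //.
  under eq_integral do rewrite gee0_abs ?lee_fin ?sqr_ge0//.
  apply: le_lt_trans (ltry (ip mu2 F F)); rewrite -sumE.
  apply: le_trans (nneseries_lim_ge j.+1 _); last first.
    by move=> n _ _; apply: integral_ge0 => x _; rewrite lee_fin sqr_ge0.
  rewrite big_nat_recr//= leeDr//; apply: sume_ge0 => n _.
  by apply: integral_ge0 => x _; rewrite lee_fin sqr_ge0.
split => //; rewrite -sumE; apply: eq_eseriesr => j _.
by rewrite ip_EFin//; under eq_integral do rewrite -expr2.
Qed.

(** Half of the two-dimensional Parseval identity, the other half being Bessel: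
if all square partial sums were at most [B < |F|^2], then letting the size grow
in one index turns them into partial sums of the norms of the slices, whose sum
is [|F|^2]. *)
Lemma parseval_tensor D e F eps : orthonormal_family mu e -> total_family mu D e ->
  L2 mu2 F -> (forall z, ~ (D `*` D) z -> F z = 0) -> 0 < eps -> exists N : nat,
  ip mu2 F F - eps < \sum_(0 <= j < N) \sum_(0 <= i < N)
    ip mu2 F (tensor_family e (i, j)) ^+ 2.
Proof.
move=> oe te LF F0 eps0; have [Ls sumE] := parseval_slice oe te LF F0.
have s0 j x : ~ D x -> slice F (e j) x = 0.
  move=> Dx; rewrite /slice /ip.
  rewrite (@eq_Rintegral _ _ _ mu setT (cst 0)) ?Rintegral_cst ?mul0r//.
  by move=> y _; rewrite F0 ?mul0r// => -[].
have [Le _] := oe.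
apply: contrapT => /forallNP lt_eps.
suff : ((ip mu2 F F)%:E <= (ip mu2 F F - eps)%:E)%E.
  by rewrite lee_fin; lra.
rewrite -[leLHS]sumE; apply: lime_le.
  by apply: is_cvg_nneseries => j _ _; rewrite lee_fin ip_ge0.
apply: nearW => n.
under eq_bigr do rewrite -(parseval oe te (Ls _) (s0 _)).
rewrite -nneseries_sum_nat; last by move=> *; rewrite lee_fin sqr_ge0.
apply: lime_le.
  apply: is_cvg_nneseries => j _ _; rewrite sumEFin lee_fin.
  by apply: sumr_ge0 => ? _; exact: sqr_ge0.
apply: nearW => m.
under eq_bigr do rewrite sumEFin.
rewrite sumEFin lee_fin.
have /negP := lt_eps (maxn m n); rewrite -leNgt; apply: le_trans.
have widen (G : nat -> R) p : (p <= maxn m n)%N -> (forall i, 0 <= G i) ->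
    \sum_(0 <= i < p) G i <= \sum_(0 <= i < maxn m n) G i.
  move=> pN G0; rewrite [leRHS](big_cat_nat _ (n := p))//= lerDl.
  by apply: sumr_ge0 => i _.
apply: (@le_trans _ _ (\sum_(0 <= i < m)
    \sum_(0 <= j < maxn m n) ip mu (slice F (e j)) (e i) ^+ 2)).
  apply: ler_sum => i _; apply: widen (leq_maxr _ _) _ => j; exact: sqr_ge0.
rewrite [leRHS]exchange_big/=.
under [leRHS]eq_bigr do under eq_bigr do rewrite ip_tensor//.
apply: widen (leq_maxl _ _) _ => i.
by apply: sumr_ge0 => j _; exact: sqr_ge0.
Qed.

End tensor.

(** * Measure-preserving maps and the reflection about 1/2 *)

Section measure_preserving.
Context {d : measure_display} {T : measurableType d} {R : realType}.

Definition measure_preserving (mu : set T -> \bar R) (phi : T -> T) :=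
  measurable_fun setT phi /\
  forall A, measurable A -> pushforward mu phi A = mu A.

Variables (mu : {measure set T -> \bar R}) (phi : T -> T).
Hypothesis phi_mp : measure_preserving mu phi.

Lemma ae_measure_preserving (P : T -> Prop) :
  {ae mu, forall x, P x} -> {ae mu, forall x, P (phi x)}.
Proof.
have [mphi mpE] := phi_mp; move=> [N [mN N0 PN]]; exists (phi @^-1` N); split.
- by rewrite -[X in measurable X]setTI; exact: mphi.
- by have := mpE N mN; rewrite N0.
- by move=> x /= nP; exact: PN.
Qed.

Lemma ge0_integral_measure_preserving (f : T -> \bar R) :
  measurable_fun setT f -> (forall x, 0 <= f x)%E ->
  (\int[mu]_x f (phi x) = \int[mu]_x f x)%E.
Proof.
have [mphi mpE] := phi_mp; move=> mf f0.
rewrite -[LHS](ge0_integral_pushforward mphi mu measurableT)//.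
by apply: eq_measure_integral => A mA _; exact: mpE.
Qed.

Lemma L2_measure_preserving f : L2 mu f -> L2 mu (f \o phi).
Proof.
have [mphi _] := phi_mp; move=> [mf /integrableP[mf2 f2]].
split; first exact: measurableT_comp.
apply/integrableP; split; first by apply: measurableT_comp mf2 mphi.
by rewrite
  (ge0_integral_measure_preserving (f := fun x => `|(f x ^+ 2)%:E|%E))//;
  exact: measurableT_comp.
Qed.

Lemma ip_measure_preserving f g : L2 mu f -> L2 mu g ->
  ip mu (f \o phi) (g \o phi) = ip mu f g.
Proof.
have [mphi mpE] := phi_mp; move=> Lf Lg; congr fine.
pose h x := (f x * g x)%:E.
have ih : mu.-integrable setT (h \o phi).
  by apply: L2_integrableM; exact: L2_measure_preserving.
have mh : measurable_fun setT h by exact: measurable_int (L2_integrableM Lf Lg).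
rewrite -[LHS](integral_pushforward mphi mh ih measurableT)//.
by apply: eq_measure_integral => A mA _; exact: mpE.
Qed.

End measure_preserving.

Section reflection.
Context {R : realType}.
Let leb : {sigma_finite_measure set (measurableTypeR R) -> \bar R} :=
  @lebesgue_measure R.

Definition mirror (x : measurableTypeR R) : measurableTypeR R := 1 - x.

Definition mirror2 (z : measurableTypeR R * measurableTypeR R) :=
  (mirror z.1, mirror z.2).

Lemma measurable_mirror : measurable_fun setT mirror.
Proof. exact: measurable_funB. Qed.
HB.instance Definition _ := isMeasurableFun.Build _ _ _ _ mirror measurable_mirror.

Lemma measurable_mirror2 : measurable_fun setT mirror2.
Proof.
by apply: measurable_fun_pair; apply: measurableT_comp measurable_mirror _;
  [exact: measurable_fst|exact: measurable_snd].
Qed.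
HB.instance Definition _ := isMeasurableFun.Build _ _ _ _ mirror2 measurable_mirror2.

Lemma mirror_measure_preserving :
  measure_preserving (@lebesgue_measure R) mirror.
Proof.
split; first exact: measurable_mirror.
move=> A mA; apply/esym.
apply: (lebesgue_measure_unique (mu := pushforward leb mirror)) => //=.
move=> _ [[a b]] _ <-.
rewrite /pushforward (_ : _ @^-1` _ = `[1 - b, 1 - a[%classic).
  rewrite /leb/= !lebesgue_measure_itv/= !lte_fin.
  rewrite ltrD2l ltrN2; case: ifPn => // _.
  by rewrite -!EFinB; congr EFin; ring.
by apply/seteqP; split => x /=; rewrite !in_itv/= /mirror => /andP[? ?];
  apply/andP; split; lra.
Qed.

Lemma mirror2_measure_preserving :
  measure_preserving (leb2 R) mirror2.
Proof.
have [_ mpE] := mirror_measure_preserving.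
split; first exact: measurable_mirror2.
move=> X mX; apply/esym.
apply: (product_measure_unique (m' := pushforward (leb2 R) mirror2)) => //.
move=> A B mA mB.
transitivity (leb2 R ((mirror @^-1` A) `*` (mirror @^-1` B))); first by [].
rewrite product_measure1E//=.
- by rewrite -[in RHS]mpE// -[in X in _ = (_ * X)%E]mpE.
- by rewrite -[X in measurable X]setTI; exact: measurable_mirror.
- by rewrite -[X in measurable X]setTI; exact: measurable_mirror.
Qed.

End reflection.

(** * Weighted spaces as subspaces of unweighted ones *)

Section unweight.
Context {T : Type} {R : realType}.
Variables (D : set T) (w : T -> R).
Hypothesis w0 : forall x, D x -> 0 <= w x.
Implicit Types u v : T -> R.

(** The isometry from the weighted space on [D] into the unweighted space on the
whole of [T], where Fubini and changes of variables carry no domain. *)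
Definition unweight u : T -> R := (fun x => u x * Num.sqrt (w x)) \_ D.

Lemma unweightE u x : D x -> unweight u x = u x * Num.sqrt (w x).
Proof. by move=> Dx; rewrite /unweight patchE mem_set. Qed.

Lemma unweight_out u x : ~ D x -> unweight u x = 0.
Proof. by move=> Dx; rewrite /unweight patchE memNset. Qed.

Lemma unweightM u v :
  (fun x => unweight u x * unweight v x) = (fun x => u x * v x * w x) \_ D.
Proof.
apply/funext => x; rewrite [RHS]patchE; case: ifPn => [/set_mem Dx|].
  by rewrite !unweightE// mulrACA -expr2 sqr_sqrtr ?w0.
by move=> /negP Dx; rewrite unweight_out ?mul0r// => Dx'; apply/Dx/mem_set.
Qed.

Lemma unweightB u v :
  unweight (fun x => u x - v x) = fun x => unweight u x - unweight v x.
Proof.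
apply/funext => x; have [Dx|Dx] := pselect (D x).
  by rewrite !unweightE// mulrBl.
by rewrite !unweight_out// subr0.
Qed.

Lemma unweightZ c u : unweight (fun x => c * u x) = fun x => c * unweight u x.
Proof.
apply/funext => x; have [Dx|Dx] := pselect (D x).
  by rewrite !unweightE// mulrA.
by rewrite !unweight_out// mulr0.
Qed.

Lemma unweight_sum (K : Type) (s : seq K) (e : K -> T -> R) :
  unweight (fun x => \sum_(k <- s) e k x) =
  fun x => \sum_(k <- s) unweight (e k) x.
Proof.
apply/funext => x; have [Dx|Dx] := pselect (D x).
  by rewrite unweightE// mulr_suml; apply: eq_bigr => k _; rewrite unweightE.
by rewrite unweight_out// big1// => k _; rewrite unweight_out.
Qed.

End unweight.

Section weighted_L2.
Context {d : measure_display} {T : measurableType d} {R : realType}.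
Variables (mu : {measure set T -> \bar R}) (D : set T) (w : T -> R).
Hypotheses (mD : measurable D) (mw : measurable_fun D w).
Hypothesis w0 : forall x, D x -> 0 <= w x.
Implicit Types u v : T -> R.
Local Notation unweight := (unweight D w).

Lemma measurable_unweight u : measurable_fun D u ->
  measurable_fun setT (unweight u).
Proof.
move=> mu'; apply/(measurable_restrict _ mD measurableT).
rewrite setTI; apply: measurable_funM => //.
apply: (measurableT_comp (f := @Num.sqrt R)) => //.
by apply: continuous_measurable_fun; exact: sqrt_continuous.
Qed.

Lemma unweight_integrable u :
  mu.-integrable D (fun x => (u x ^+ 2 * w x)%:E) <->
  mu.-integrable setT (fun x => (unweight u x ^+ 2)%:E).
Proof.
rewrite (integrable_mkcond _ mD) restrict_EFin.
by rewrite (_ : (fun x => (unweight u x ^+ 2)%:E) =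
  EFin \o ((fun x => u x ^+ 2 * w x) \_ D))// -unweightM.
Qed.

Lemma in_L2w_unweight u : in_L2w mu D w u <->
  measurable_fun D u /\ L2 mu (unweight u).
Proof.
split=> [[mu' /unweight_integrable iu]|[mu' [_ iu]]].
  by split => //; split => //; exact: measurable_unweight.
by split => //; exact/unweight_integrable.
Qed.

Lemma sq_dist_unweight u v (g := fun x => unweight u x - unweight v x) :
  L2 mu (unweight u) -> L2 mu (unweight v) ->
  sq_dist mu D w u v = (ip mu g g)%:E.
Proof.
move=> Lu Lv; have Lg : L2 mu g by exact: L2B.
rewrite ip_EFin// /sq_dist integral_mkcond restrict_EFin.
congr integral; rewrite [in RHS](_ : (fun x => (g x * g x)%:E) =
  EFin \o ((fun x => (u x - v x) * (u x - v x) * w x) \_ D))//.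
by rewrite -(unweightM w0 (fun x => u x - v x)) unweightB.
Qed.

Lemma unweight_ae_inj u v : {ae mu, forall x, D x -> 0 < w x} ->
  unweight u = unweight v %[ae mu] -> u = v %[ae mu in D].
Proof.
move=> wpos uv; apply: filterS2 wpos uv => x wx /(_ Logic.I) + Dx.
rewrite !unweightE// => /mulIf; apply.
by rewrite gt_eqF// sqrtr_gt0 wx.
Qed.

Lemma unweight_ae_eq u v :
  u = v %[ae mu in D] -> unweight u = unweight v %[ae mu].
Proof.
apply: filterS => x uv _; have [Dx|Dx] := pselect (D x).
  by rewrite !unweightE// uv.
by rewrite !unweight_out.
Qed.

Lemma unweight_comp (phi : T -> T) u : (forall x, D (phi x) <-> D x) ->
  w = w \o phi %[ae mu in D] ->
  unweight (u \o phi) = unweight u \o phi %[ae mu].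
Proof.
move=> Dphi; apply: filterS => x wE _ /=; have [Dx|Dx] := pselect (D x).
  by rewrite !unweightE ?wE//; exact/Dphi.
by rewrite !unweight_out// => /Dphi.
Qed.

End weighted_L2.

Lemma unweight2 {R : realType} (I : set R) (w u v : R -> R) :
  (forall x, I x -> 0 <= w x) ->
  unweight (I `*` I) (weight2 w) (fun z => u z.1 * v z.2)
  = tensor (unweight I w u) (unweight I w v).
Proof.
move=> w0; apply/funext => -[x y].
have [[Ix Iy]|nI] := pselect ((I `*` I) (x, y)).
  rewrite unweightE// /tensor/= !unweightE// /weight2/= sqrtrM ?w0//.
  by rewrite mulrACA.
rewrite unweight_out// /tensor/=.
have [Ix|Ix] := pselect (I x); last by rewrite unweight_out ?mul0r.
by rewrite (unweight_out _ _ (x := y)) ?mulr0// => Iy; apply: nI.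
Qed.

Section product_ae.
Context {d : measure_display} {T : measurableType d} {R : realType}.
Variable mu : {sigma_finite_measure set T -> \bar R}.

Lemma ae_fst (P : T -> Prop) : {ae mu, forall x, P x} ->
  {ae (mu \x mu)%E, forall z, P z.1}.
Proof.
move=> [N [mN N0 PN]]; exists (N `*` setT); split.
- exact: measurableX.
- transitivity (mu N * mu setT)%E; first exact: product_measure1E.
  by rewrite N0 mul0e.
- by move=> [x y] /= nP; split => //; exact: PN.
Qed.

Lemma ae_snd (P : T -> Prop) : {ae mu, forall x, P x} ->
  {ae (mu \x mu)%E, forall z, P z.2}.
Proof.
move=> [N [mN N0 PN]]; exists (setT `*` N); split.
- exact: measurableX.
- transitivity (mu setT * mu N)%E; first exact: product_measure1E.
  by rewrite N0 mule0.
- by move=> [x y] /= nP; split => //; exact: PN.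
Qed.

End product_ae.

Lemma measurable_horner {R : realType} (p : {poly R})
    (D : set (measurableTypeR R)) :
  measurable_fun D (horner p : measurableTypeR R -> R).
Proof.
apply: measurable_funTS; rewrite (_ : horner p =
    fun x => \sum_(i <- index_iota 0 (size p)) (p`_i * x ^+ i)).
  by apply: measurable_sum => i; apply: measurable_funM => //; exact: measurable_funX.
by apply/funext => x; rewrite horner_coef big_mkord.
Qed.

Section weight_functions.
Context {R : realType}.
Variables (I : set R) (w : R -> R).

Lemma symmetric_domain_measurable : symmetric_domain I ->
  measurable (I : set (measurableTypeR R)).
Proof. by move=> [[a [b [_ _ ->]]]|->]. Qed.

Lemma symmetric_domainP x : symmetric_domain I -> I (1 - x) <-> I x.
Proof.
move=> [[a [b [ab ab1 ->]]]|->//]; rewrite /= !in_itv/=.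
by split => /andP[? ?]; apply/andP; split; lra.
Qed.

Hypotheses (mI : measurable (I : set (measurableTypeR R))).
Hypothesis ww : weight_function I w.

Lemma weight_function_measurable :
  measurable_fun (I : set (measurableTypeR R)) w.
Proof.
have [_ /(_ 0%N) + _] := ww => /measurable_int/measurable_EFinP.
by under eq_fun do rewrite expr0 mul1r.
Qed.

(** The indicator of the zero set of [w] is a non-negative function with
vanishing weighted integral. *)
Lemma weight_function_gt0 : {ae leb R, forall x, I x -> 0 < w x}.
Proof.
have [w0 _ w1] := ww.
pose Z : set (measurableTypeR R) := I `&` w @^-1` [set 0].
have mZ : measurable Z by apply: weight_function_measurable.
have /w1 : measurable_fun (I : set (measurableTypeR R)) (\1_Z : _ -> R).
  exact: measurable_indic.
move=> /(_ (fun x _ => ltac:(by rewrite indicE))).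
have -> : (\int[leb R]_(x in I) (\1_Z x * w x)%:E = 0)%E.
  apply: integral0_eq => x Ix; rewrite indicE; case: (boolP (x \in Z)).
    by move=> /set_mem[_ /= ->]; rewrite mulr0.
  by rewrite mul0r.
move=> /(_ erefl); apply: aeS => x wx Ix.
rewrite lt_neqAle w0// andbT eq_sym; apply/negP => /eqP wx0.
have := wx Ix; rewrite indicE mem_set//= => /eqP.
by rewrite oner_eq0.
Qed.

Lemma weight_function_integrable_poly (p : {poly R}) :
  (leb R).-integrable I (fun x => (p.[x] * w x)%:E).
Proof.
have [_ wm _] := ww.
have -> : (fun x => (p.[x] * w x)%:E) =
    (fun x => \sum_(i <- index_iota 0 (size p)) (p`_i)%:E * (x ^+ i * w x)%:E)%E.
  apply/funext => x; rewrite sumEFin horner_coef mulr_suml big_mkord.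
  by congr EFin; apply: eq_bigr => i _; rewrite mulrA.
apply: integrable_sum => // i _; exact: integrableZl.
Qed.

Lemma weight_function_L2_poly (p : {poly R}) :
  L2 (leb R) (unweight I w (horner p)).
Proof.
have [w0 _ _] := ww; have mw := weight_function_measurable.
apply: (iffLR (in_L2w_unweight _ mI mw w0 _) _).2; split.
  exact: measurable_horner.
apply: eq_integrable (weight_function_integrable_poly (p ^+ 2)) => // x _.
by rewrite horner_exp.
Qed.

End weight_functions.

(** * Kernels invariant under the reflection *)

Lemma ler_sum_subset {R : realType} {K : eqType} (s t : seq K) (G : K -> R) :
  (forall k, 0 <= G k) -> uniq s -> uniq t -> {subset s <= t} ->
  \sum_(k <- s) G k <= \sum_(k <- t) G k.
Proof.
move=> G0 us ut st; have stE : \sum_(k <- t | k \in s) G k = \sum_(k <- s) G k.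
  rewrite -big_filter; apply: perm_big; apply: uniq_perm => //.
    exact: filter_uniq.
  by move=> k; rewrite mem_filter; case: (boolP (k \in s)) => //= /st ->.
by rewrite [leRHS](bigID [in s])/= stE lerDl sumr_ge0.
Qed.

Section symmetric_kernels.
Context {R : realType}.
Variables (I : set R) (w : R -> R) (P : nat -> {poly R}).
Hypotheses (I_sym : symmetric_domain I) (w_weight : weight_function I w).
Hypothesis w_sym : w = (fun x => w (1 - x)) %[ae leb R in I].
Hypothesis P_orthonormal : orthonormal_polynomials I w P.
Hypothesis P_complete : complete_polynomials I w P.
Hypothesis P_sym :
  forall (n : nat) (x : R), (P n).[1 - x] = (-1) ^+ n * (P n).[x].

Let mI := symmetric_domain_measurable I_sym.
Let w0 : forall x, I x -> 0 <= w x. Proof. by have [] := w_weight. Qed.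
Let mw := weight_function_measurable w_weight.

Let II := I `*` I.
Let mII : measurable (II : set (measurableTypeR R * measurableTypeR R)).
Proof. exact: measurableX. Qed.

Let w20 z : II z -> 0 <= weight2 w z.
Proof. by move=> [? ?]; rewrite mulr_ge0// w0. Qed.

Let mw2 : measurable_fun (II : set (measurableTypeR R * measurableTypeR R))
  (weight2 w).
Proof.
apply: measurable_funM.
- apply: (measurable_comp mI _ mw); first by move=> _ [z [? ?] <-].
  exact: measurable_funTS measurable_fst.
- apply: (measurable_comp mI _ mw); first by move=> _ [z [? ?] <-].
  exact: measurable_funTS measurable_snd.
Qed.

Let w2_gt0 : {ae leb2 R, forall z, II z -> 0 < weight2 w z}.
Proof.
have wpos := weight_function_gt0 mI w_weight.
have := aeI (ae_fst wpos) (ae_snd wpos).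
by apply: aeS => z [w1 w2] [I1 I2]; rewrite mulr_gt0 ?w1 ?w2.
Qed.

Let w2_sym : weight2 w = weight2 w \o mirror2 %[ae leb2 R in II].
Proof.
have := aeI (ae_fst w_sym) (ae_snd w_sym).
by apply: aeS => z [w1 w2] [I1 I2]; rewrite /weight2/= w1// w2.
Qed.

Let II_mirror z : II (mirror2 z) <-> II z.
Proof.
by split=> -[/= I1 I2]; split; apply/(symmetric_domainP _ I_sym);
  rewrite ?opprB ?addrCA ?subrr ?addr0.
Qed.

Let e n : R -> R := unweight I w (horner (P n)).
Let U : (R * R -> R) -> R * R -> R := unweight II (weight2 w).

Definition poly_tensor (ij : nat * nat) (z : R * R) : R :=
  (P ij.1).[z.1] * (P ij.2).[z.2].

Lemma unweight_poly_tensor ij : U (poly_tensor ij) = tensor_family e ij.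
Proof. exact: (unweight2 (horner (P ij.1)) (horner (P ij.2)) w0). Qed.

Let inner_unweight u v :
  inner I w u v = ip (leb R) (unweight I w u) (unweight I w v).
Proof.
rewrite /inner Rintegral_mkcond /ip; apply: eq_Rintegral => x _.
by rewrite -(unweightM w0).
Qed.

Lemma orthonormal_unweight_poly : orthonormal_family (leb R) e.
Proof.
split=> [n|i j]; first exact: weight_function_L2_poly.
by have [_ <-] := P_orthonormal; rewrite inner_unweight.
Qed.

Let P0_const : exists2 c, c != 0 & forall x, (P 0%N).[x] = c.
Proof.
have [/(_ 0%N)/eqP/size_poly1P[c c0 ->] _] := P_orthonormal.
by exists c => // x; rewrite hornerC.
Qed.

(** [P_1] is odd about [1/2], hence a multiple of [x - 1/2]; pairing [x] with
[P_1] recovers the factor since constants are orthogonal to [P_1]. *)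
Lemma poly1E x :
  x - 1 / 2 = inner I w (fun y => y) (horner (P 1%N)) * (P 1%N).[x].
Proof.
have [Psize _] := P_orthonormal; have [c c0 P0E] := P0_const.
have [Le eo] := orthonormal_unweight_poly.
pose a := (P 1%N)`_0; pose b := (P 1%N)`_1.
have P1E y : (P 1%N).[y] = a + b * y.
  by rewrite horner_coef Psize 2!big_ord_recl big_ord0/= expr0 expr1 mulr1 addr0.
have b0 : b != 0.
  have : lead_coef (P 1%N) != 0 by rewrite lead_coef_eq0 -size_poly_eq0 Psize.
  by rewrite /lead_coef Psize.
have aE : a = - b / 2 by have := P_sym 1 0; rewrite !P1E expr1; lra.
have xE y : y - 1 / 2 = b^-1 * (P 1%N).[y].
  by rewrite P1E aE; field.
(* y = (y - 1 / 2) + 1 / 2, and 1 / 2 = P_0 / (2 c) since P_0 = c. *)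
have idE : unweight I w (fun y => y) =
    fun y => b^-1 * e 1%N y + (2 * c)^-1 * e 0%N y.
  apply/funext => y; have [Iy|Iy] := pselect (I y).
    rewrite /e !unweightE// !mulrA -mulrDl -xE P0E; congr (_ * _).
    by field.
  by rewrite /e !unweight_out// !mulr0 addr0.
rewrite inner_unweight idE -/(e 1%N).
have Lb := L2Z b^-1 (Le 1%N); have Lc := L2Z (2 * c)^-1 (Le 0%N).
by rewrite (ipDl Lb Lc (Le 1%N)) !ipZl// !eo mulr1 mulr0 addr0.
Qed.

(** Dividing [f] by the square root of the weight brings it back to the weighted
space, up to the null set where the weight vanishes. *)
Lemma total_unweight_poly : total_family (leb R) I e.
Proof.
move=> f Lf f0 eps eps0; have [mf _] := Lf.
pose u x := f x * Num.sqrt (w x) `^ (-1).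
have mu : measurable_fun (I : set (measurableTypeR R)) u.
  apply: measurable_funM; first exact: measurable_funTS.
  apply: (measurableT_comp (f := fun y : R => y `^ (-1))); first exact: measurable_powR.
  apply: (measurableT_comp (f := @Num.sqrt R)) => //.
  by apply: continuous_measurable_fun; exact: sqrt_continuous.
have fu : f = unweight I w u %[ae leb R].
  have := weight_function_gt0 mI w_weight; apply: aeS => x wx _.
  have [Ix|Ix] := pselect (I x); last by rewrite f0// unweight_out.
  rewrite unweightE// /u powR_inv1 ?sqrtr_ge0// mulfVK//.
  by rewrite gt_eqF// sqrtr_gt0 wx.
have Lu : L2 (leb R) (unweight I w u).
  by apply: L2_ae_eq fu Lf; exact: measurable_unweight.
have /P_complete/(_ eps eps0)[n [c]] : in_L2w (leb R) I w u.
  exact/(in_L2w_unweight _ mI mw w0).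
pose p x := \sum_(0 <= i < n) c i * (P i).[x].
rewrite (_ : (fun x => \sum_(i < n) _) = p); last first.
  by apply/funext => x; rewrite /p big_mkord.
have pE : unweight I w p = fun x => \sum_(0 <= i < n) c i * e i x.
  rewrite (unweight_sum _ _ _ (fun i x => c i * (P i).[x])).
  by apply/funext => x; apply: eq_bigr => i _; rewrite unweightZ.
have [Le _] := orthonormal_unweight_poly.
have Lp : L2 (leb R) (unweight I w p).
  rewrite pE; exact: (L2_sum (index_iota 0 n) (fun i => L2Z (c i) (Le i))).
rewrite (sq_dist_unweight (mu := leb R) w0 Lu Lp) lte_fin => lt_eps.
exists n, c; apply: le_lt_trans lt_eps.
rewrite (_ : (fun x => f x - _) = fun x => f x - unweight I w p x); last first.
  by rewrite pE.
have Lfp := L2B Lf Lp; have Lup := L2B Lu Lp.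
have fpup : (fun x => f x - unweight I w p x) =
    (fun x => unweight I w u x - unweight I w p x) %[ae leb R].
  by move: fu; apply: aeS => x fux _; rewrite fux.
by rewrite (eq_ip Lfp Lfp Lup Lup).
Qed.

Lemma poly_tensor_mirror ij z :
  poly_tensor ij (mirror2 z) = (-1) ^+ (ij.1 + ij.2) * poly_tensor ij z.
Proof. by rewrite /poly_tensor /= !P_sym exprD; ring. Qed.

Definition kernel_coef (S : R * R -> R) ij : R :=
  ip (leb2 R) (U S) (tensor_family e ij).

Definition centrally_symmetric (S : R * R -> R) :=
  S = S \o mirror2 %[ae leb2 R in II].

Let in_L2wP S : in_L2w (leb2 R) II (weight2 w) S <->
  measurable_fun (II : set (measurableTypeR R * measurableTypeR R)) S /\
  L2 (leb2 R) (U S).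
Proof. exact: in_L2w_unweight. Qed.

Let L2_tensor_family ij : L2 (leb2 R) (tensor_family e ij).
Proof. by have [Le _] := orthonormal_tensor orthonormal_unweight_poly. Qed.

(** The reflection preserves the pairing, fixes [S] and changes the sign of
[P_i P_j]. *)
Lemma kernel_coef_odd S ij : in_L2w (leb2 R) II (weight2 w) S ->
  centrally_symmetric S -> odd (ij.1 + ij.2) -> kernel_coef S ij = 0.
Proof.
move=> /in_L2wP[_ LS] Ssym oij.
have mp := @mirror2_measure_preserving R.
have LSm := L2_measure_preserving mp LS.
have Lem := L2_measure_preserving mp (L2_tensor_family ij).
have SE : U S = U S \o mirror2 %[ae leb2 R].
  have h1 := @unweight_ae_eq _ _ _ (leb2 R) II (weight2 w) _ _ Ssym.
  have h2 := @unweight_comp _ _ _ (leb2 R) II (weight2 w) mirror2 S II_mirror w2_sym.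
  by have := aeI h1 h2; apply: aeS => z [uz vz] _;
    exact: etrans (uz Logic.I) (vz Logic.I).
have eE : tensor_family e ij \o mirror2 = (fun z => -1 * tensor_family e ij z)
    %[ae leb2 R].
  rewrite -unweight_poly_tensor.
  have := @unweight_comp _ _ _ (leb2 R) II (weight2 w) mirror2 (poly_tensor ij)
    II_mirror w2_sym.
  apply: aeS => z /(_ Logic.I) <- _.
  rewrite (_ : _ \o _ = fun z => -1 * poly_tensor ij z) ?unweightZ//.
  by apply/funext => t /=; rewrite poly_tensor_mirror -signr_odd oij expr1.
have Lne : L2 (leb2 R) (fun z => -1 * tensor_family e ij z) by exact: L2Z.
have : kernel_coef S ij = - kernel_coef S ij.
  rewrite -[LHS](ip_measure_preserving mp LS (L2_tensor_family ij)).
  have SE' : U S \o mirror2 = U S %[ae leb2 R].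
    by move: SE; apply: aeS => z h _; rewrite h.
  by rewrite (eq_ip LSm Lem LS Lne SE' eE) ipC ipZl// mulN1r ipC.
by lra.
Qed.

Let unweight_partial_sum (K : pred (nat * nat)) (alpha : nat * nat -> R)
    (s : seq (nat * nat)) (c := fun ij => (K ij)%:R * alpha ij) :
  U (fun z => \sum_(ij <- s | K ij) alpha ij * (P ij.1).[z.1] * (P ij.2).[z.2])
  = fun z => \sum_(ij <- s) c ij * tensor_family e ij z.
Proof.
rewrite (_ : (fun z => _) = (fun z => \sum_(ij <- s) c ij * poly_tensor ij z)).
  rewrite /U (unweight_sum _ _ _ (fun ij z => c ij * poly_tensor ij z)).
  apply/funext => z; apply: eq_bigr => ij _.
  by rewrite unweightZ -unweight_poly_tensor.
apply/funext => z; rewrite big_mkcond; apply: eq_bigr => ij _.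
by rewrite /c /poly_tensor; case: (K ij); rewrite ?mul1r ?mul0r ?mulrA.
Qed.

Let L2_partial_sum (s : seq (nat * nat)) (c : nat * nat -> R) :
  L2 (leb2 R) (fun z => \sum_(ij <- s) c ij * tensor_family e ij z).
Proof.
exact: (L2_sum s (fun ij => L2Z (c ij) (L2_tensor_family ij))).
Qed.

(** The squared distance from [S] to its partial sum over [F] is
[|S|^2 - \sum_(k in F) coef_k ^2]. It decreases when [F] grows, and it is small for
the square sets of indices of [parseval_tensor]. *)
Lemma L2w_double_sum_kernel_coef (K : pred (nat * nat)) alpha S :
  in_L2w (leb2 R) II (weight2 w) S ->
  (forall ij, K ij -> alpha ij = kernel_coef S ij) ->
  (forall ij, ~~ K ij -> kernel_coef S ij = 0) ->
  L2w_double_sum I w P K alpha S.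
Proof.
move=> L2S aE K0; split => //; have [_ LS] := (in_L2wP _).1 L2S.
have oe := orthonormal_unweight_poly; have oe2 := orthonormal_tensor oe.
have cE ij : (K ij)%:R * alpha ij = kernel_coef S ij.
  by case: (boolP (K ij)) => [/aE ->|/K0 ->]; rewrite ?mul1r ?mul0r.
pose r (F : {fset nat * nat}) :=
  ip (leb2 R) (U S) (U S) - \sum_(ij <- F) kernel_coef S ij ^+ 2.
have distE (F : {fset nat * nat}) :
    sq_dist (leb2 R) II (weight2 w) S
      (fun z => \sum_(ij <- F | K ij) alpha ij * (P ij.1).[z.1] * (P ij.2).[z.2])
    = (r F)%:E.
  have := L2_partial_sum F (fun ij => (K ij)%:R * alpha ij).
  rewrite -unweight_partial_sum => Lp.
  rewrite (sq_dist_unweight (mu := leb2 R) w20 LS Lp) -/U unweight_partial_sum.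
  rewrite (ip_subcomb _ oe2 (fset_uniq F) LS) [X in _ + X]big1 ?addr0// => ij _.
  by rewrite cE subrr expr0n.
suff : (r F)%:E @[F --> totally] --> 0%E by rewrite -(funext distE).
have totF : Filter (@totally (nat * nat)%type).
  exact: (@filter_filter _ _ totally_filter).
apply: cvg_EFin; first by apply: nearW.
apply/cvgrPdist_lt => eps eps0.
have US0 z : ~ (I `*` I) z -> U S z = 0 by exact: unweight_out.
have [N ltN] := parseval_tensor oe total_unweight_poly LS US0 eps0.
pose s := [seq (i, j) | j <- index_iota 0 N, i <- index_iota 0 N].
have us : uniq s.
  apply: allpairs_uniq; [exact: iota_uniq|exact: iota_uniq|].
  by move=> [i j] [i' j'] _ _ /= [-> ->].
exists (seq_fset tt s) => // F /fsubsetP sF /=.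
have sub : {subset s <= F} by move=> ij ijs; apply: sF; rewrite seq_fsetE.
have rF0 : 0 <= r F by rewrite subr_ge0; exact: bessel.
rewrite sub0r normrN ger0_norm// /r ltrBlDr -ltrBlDl.
apply: lt_le_trans ltN _.
rewrite -(big_allpairs_dep (h := fun j i : nat => (i, j))
  (F := fun ij => kernel_coef S ij ^+ 2)).
by apply: ler_sum_subset us (fset_uniq F) sub => ij; exact: sqr_ge0.
Qed.

Let in_L2w_poly_tensor ij :
  in_L2w (leb2 R) II (weight2 w) (poly_tensor ij).
Proof.
apply/in_L2wP; split; last by rewrite unweight_poly_tensor.
have m1 := measurableT_comp (measurable_horner (P ij.1) (D := setT))
  (@measurable_fst _ _ (measurableTypeR R) (measurableTypeR R)).
have m2 := measurableT_comp (measurable_horner (P ij.2) (D := setT))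
  (@measurable_snd _ _ (measurableTypeR R) (measurableTypeR R)).
by apply: measurable_funTS; exact: measurable_funM m1 m2.
Qed.

Let in_L2w_subZ S S' c : in_L2w (leb2 R) II (weight2 w) S ->
  in_L2w (leb2 R) II (weight2 w) S' ->
  in_L2w (leb2 R) II (weight2 w) (fun z => S z - c * S' z).
Proof.
move=> /in_L2wP[mS LS] /in_L2wP[mS' LS']; apply/in_L2wP; split.
  by apply: measurable_funB => //; exact: measurable_funM.
by rewrite /U unweightB unweightZ; apply: L2B => //; exact: L2Z.
Qed.

(** Since [P_0] is a constant [c], [P_1(tau)] and [P_1(sigma)] are multiples of
products of two polynomials of the family. *)
Lemma in_L2w_add_poly1 S a b : in_L2w (leb2 R) II (weight2 w) S ->
  in_L2w (leb2 R) II (weight2 w)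
    (fun z => S z - a * (P 1%N).[z.1] + b * (P 1%N).[z.2]).
Proof.
move=> L2S; have [c c0 P0E] := P0_const.
have L2S1 := in_L2w_subZ (a / c) L2S (in_L2w_poly_tensor (1, 0)%N).
have := in_L2w_subZ (- b / c) L2S1 (in_L2w_poly_tensor (0, 1)%N).
congr in_L2w; apply/funext => z; rewrite /poly_tensor/= !P0E.
by field.
Qed.

(** The term of index (0, 0) is the constant [a]. Once it is removed, symmetry
kills the coefficients with [i + j] odd, in particular both with [i + j = 1]. *)
Lemma symmetric_kernel_expansion S : in_L2w (leb2 R) II (weight2 w) S ->
  centrally_symmetric S ->
  exists a : R, forall alpha,
    (forall ij, (1 < ij.1 + ij.2)%N ->
      alpha ij = kernel_coef (fun z => S z - a) ij) ->
    L2w_double_sum I w P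
      (fun ij => ~~ odd (ij.1 + ij.2) && (1 < ij.1 + ij.2)%N) alpha
      (fun z => S z - a).
Proof.
move=> L2S Ssym; have [c c0 P0E] := P0_const.
have [_ LS] := (in_L2wP _).1 L2S.
pose k := kernel_coef S (0, 0)%N; exists (k * (c * c)) => alpha alphaE.
have SE : (fun z => S z - k * (c * c)) = (fun z => S z - k * poly_tensor (0, 0)%N z).
  by apply/funext => z; rewrite /poly_tensor/= !P0E.
have L2S' : in_L2w (leb2 R) II (weight2 w) (fun z => S z - k * (c * c)).
  by rewrite SE; apply: in_L2w_subZ.
apply: L2w_double_sum_kernel_coef => //.
  by move=> ij /andP[_]; exact: alphaE.
move=> ij; rewrite negb_and negbK => /orP[oij|].
  apply: kernel_coef_odd => //; move: Ssym; apply: aeS => z Sz Iz.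
  by rewrite /= Sz.
have [_ eo] := orthonormal_tensor orthonormal_unweight_poly.
case: ij => -[|[|i]] [|[|j]]//= _; last 2 first.
- by apply: kernel_coef_odd => //; move: Ssym; apply: aeS => z Sz Iz; rewrite /= Sz.
- by apply: kernel_coef_odd => //; move: Ssym; apply: aeS => z Sz Iz; rewrite /= Sz.
rewrite /kernel_coef SE /U unweightB unweightZ -/U unweight_poly_tensor.
have Le00 := L2_tensor_family (0, 0)%N.
by rewrite (ipBl LS (L2Z k Le00) Le00) ipZl// eo eqxx mulr1 subrr.
Qed.

(** A partial sum [p] of even terms is invariant under the reflection, which is
isometric, so [|S - S o rho|^2 <= 4 |S - p|^2], and the right-hand side is as
small as desired. *)
Lemma L2w_double_sum_symmetric (K : pred (nat * nat)) alpha S :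
  (forall ij, K ij -> ~~ odd (ij.1 + ij.2)) ->
  L2w_double_sum I w P K alpha S -> centrally_symmetric S.
Proof.
move=> Keven [/in_L2wP[_ LS] cvgS].
have mp := @mirror2_measure_preserving R.
have LSm := L2_measure_preserving mp LS.
have USm := @unweight_comp _ _ _ (leb2 R) II (weight2 w) mirror2 S II_mirror w2_sym.
pose f := U S; pose D z := f z - f (mirror2 z).
have LD : L2 (leb2 R) D := L2B LS LSm.
suff D0 : ip (leb2 R) D D = 0.
  have fE : U S = U (S \o mirror2) %[ae leb2 R].
    have := aeI (ip_eq0 LD D0) USm; apply: aeS => z [/(_ Logic.I) Dz vz] _.
    by apply: etrans (esym (vz Logic.I)); apply/eqP; rewrite -subr_eq0; exact/eqP.
  exact: (@unweight_ae_inj _ _ _ (leb2 R) II (weight2 w) _ _ w2_gt0 fE).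
apply/eqP; rewrite eq_le ip_ge0 andbT; apply/ler_addgt0Pr => eps eps0.
rewrite add0r.
have /cvgS[F _ /(_ F (fsubset_refl F))] :
    nbhs 0%:E [set y : \bar R | (y < (eps / 4)%:E)%E].
  by apply: (nbhs_open_ereal_lt (f := fun=> eps / 4)); rewrite divr_gt0.
rewrite /=; set p := (fun z => \sum_(ij <- F | K ij) _).
have Lp : L2 (leb2 R) (U p).
  have := L2_partial_sum F (fun ij => (K ij)%:R * alpha ij).
  by rewrite -unweight_partial_sum.
rewrite (sq_dist_unweight (mu := leb2 R) w20 LS Lp) lte_fin.
pose g z := U S z - U p z; rewrite -/g => lt_eps.
have Lg : L2 (leb2 R) g := L2B LS Lp.
have Lgm := L2_measure_preserving mp Lg.
have Up := @unweight_comp _ _ _ (leb2 R) II (weight2 w) mirror2 p II_mirror w2_sym.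
have pm : p \o mirror2 = p.
  apply/funext => z; apply: eq_bigr => ij /Keven even_ij.
  rewrite -!mulrA -/(poly_tensor ij (mirror2 z)) poly_tensor_mirror.
  by rewrite -signr_odd (negbTE even_ij) expr0 mul1r.
have DE : D = (fun z => g z - (g \o mirror2) z) %[ae leb2 R].
  move: Up; apply: aeS => z /(_ Logic.I); rewrite pm => pz _.
  have pz' : U p z = U p (mirror2 z) by exact: pz.
  by rewrite /D /g /f /= pz'; ring.
have LB := L2B Lg Lgm.
rewrite (eq_ip LD LD LB LB DE DE).
apply: le_trans (ip_sub_le Lg Lgm) _.
rewrite (ip_measure_preserving mp Lg Lg).
by move: lt_eps; set t := ip _ _ _; lra.
Qed.


End symmetric_kernels.

(** * The symmetry condition *)

Section symmetric_methods.
Context {R : realType}.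
Variables (I : set R) (w : R -> R) (M : csRKN R).
Hypotheses (I_sym : symmetric_domain I) (w_weight : weight_function I w).
Hypothesis w_sym : w = (fun x => w (1 - x)) %[ae leb R in I].
Hypothesis C_id : Ccoef M = (fun t => t) %[ae leb R in I].
Hypothesis Bbar_eq :
  Bbar M = (fun t => Bcoef M t * (1 - Ccoef M t)) %[ae leb R in I].
Hypothesis B_neq0 : {ae leb R, forall s, I s -> Bcoef M s <> 0}.

(** The pointwise facts at [x] that hold for almost every [x] of [I]. *)
Let regular (x : measurableTypeR R) := I x ->
  [/\ Ccoef M x = x, Bbar M x = Bcoef M x * (1 - x), Bcoef M x != 0 & 0 < w x].

Let ae_regular : {ae leb R, forall x, regular x /\ regular (mirror x)}.
Proof.
have reg : {ae leb R, forall x, regular x}.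
  have wpos := weight_function_gt0 (symmetric_domain_measurable I_sym) w_weight.
  have := aeI (aeI C_id Bbar_eq) (aeI B_neq0 wpos).
  apply: aeS => x [[Cx Bx] [Bx0 wx]] Ix; split; rewrite ?wx ?Cx//.
    by rewrite Bx// Cx.
  exact/eqP/Bx0.
exact: aeI reg (ae_measure_preserving mirror_measure_preserving reg).
Qed.

(** The quotient [Abar / B] changes by [tau - sigma] under the reflection, and
[(tau - sigma) / 2] does too: the difference is invariant. *)
Definition centered_kernel (z : R * R) : R :=
  Abar M z.1 z.2 / Bcoef M z.2 - (z.1 - z.2) / 2.

(** At a regular point the conditions on [C] and [Bbar] follow from the one on
[B], which by [w(x) = w(1 - x) > 0] is the symmetry of [B], and the condition on
[Abar], divided by [B(sigma) w(sigma)], is the invariance of the centered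
kernel. *)
Lemma symmetric_conditionP : symmetric_condition I w M <->
  Bcoef M = (fun s => Bcoef M (1 - s)) %[ae leb R in I] /\
  centrally_symmetric I centered_kernel.
Proof.
pose good x := (regular x /\ regular (mirror x)) /\ (I x -> w x = w (1 - x)).
have ae_good : {ae leb R, forall x, good x} := aeI ae_regular w_sym.
have ImP x : I x -> I (1 - x) by move/(symmetric_domainP _ I_sym).
have BP x : good x -> I x ->
    (Bcoef M x * w x = Bcoef M (1 - x) * w (1 - x)) <->
    Bcoef M x = Bcoef M (1 - x).
  move=> [[rx _] wx] Ix; have [_ _ _ wx0] := rx Ix; rewrite -wx//.
  by split=> [/mulIf|->//]; apply; rewrite gt_eqF.
have AP z : good z.1 -> good z.2 -> (I `*` I) z ->
    Bcoef M z.2 = Bcoef M (1 - z.2) ->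
    (Abar M z.1 z.2 * w z.2 =
      (Bcoef M (1 - z.2) * (1 - Ccoef M (1 - z.1)) - Bbar M (1 - z.2)
       + Abar M (1 - z.1) (1 - z.2)) * w (1 - z.2)) <->
    centered_kernel z = centered_kernel (mirror2 z).
  move=> [[_ r1] _] [[r2 r2'] w2] [I1 I2] Bz.
  have [C1 _ _ _] := r1 (ImP _ I1).
  have [_ _ B0 w20] := r2 I2.
  have [_ Bb2 _ _] := r2' (ImP _ I2).
  rewrite -w2// /mirror in C1 Bb2 *.
  rewrite C1 Bb2 /centered_kernel /= /mirror -Bz.
  split=> [/mulIf -> |].
  - by field.
  - by rewrite gt_eqF.
  move=> E; congr (_ * _); apply: (mulIf (invr_neq0 B0)).
  move: E => /eqP; rewrite subr_eq => /eqP ->.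
  by field.
split=> [[_ cA _ cB]|[Bsym Hsym]].
  have Bsym : Bcoef M = (fun s => Bcoef M (1 - s)) %[ae leb R in I].
    by have := aeI ae_good cB; apply: aeS => x [gx cBx] Ix; apply/(BP _ gx Ix)/cBx.
  split => //.
  have := aeI (aeI (ae_fst ae_good) (ae_snd ae_good)) (aeI (ae_snd Bsym) cA).
  apply: aeS => z [[g1 g2] [Bz cAz]] Iz; apply/(AP _ g1 g2 Iz).
    by apply: Bz; case: Iz.
  exact: cAz.
split.
- have := ae_good; apply: aeS => x [[rx rx'] _] Ix.
  have [-> _ _ _] := rx Ix; have [C1 _ _ _] := rx' (ImP _ Ix).
  by rewrite /mirror in C1; rewrite C1; ring.
- have := aeI (aeI (ae_fst ae_good) (ae_snd ae_good)) (aeI (ae_snd Bsym) Hsym).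
  apply: aeS => z [[g1 g2] [Bz Hz]] Iz; apply/(AP _ g1 g2 Iz).
    by apply: Bz; case: Iz.
  exact: Hz.
- have := aeI ae_good Bsym; apply: aeS => x [[[rx rx'] wx] Bx] Ix.
  have [_ -> _ _] := rx Ix; have [_ B1 _ _] := rx' (ImP _ Ix).
  by rewrite /mirror in B1; rewrite B1 -wx// -Bx//; ring.
- by have := aeI ae_good Bsym; apply: aeS => x [gx Bx] Ix; apply/(BP _ gx Ix)/Bx.
Qed.

End symmetric_methods.

Unset Implicit Arguments.

Theorem theorem4p13 (R : realType) (I : set R) (w : R -> R)
    (P : nat -> {poly R}) (M : csRKN R)
    (I_sym : symmetric_domain I)
    (w_weight : weight_function I w)
    (w_sym : w = (fun x => w (1 - x)) %[ae leb R in I])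
    (P_orthonormal : orthonormal_polynomials I w P)
    (P_complete : complete_polynomials I w P)
    (P_sym : forall (n : nat) (x : R), (P n).[1 - x] = (-1) ^+ n * (P n).[x])
    (C_id : Ccoef M = (fun t => t) %[ae leb R in I])
    (Bbar_eq : Bbar M = (fun t => Bcoef M t * (1 - Ccoef M t)) %[ae leb R in I])
    (B_neq0 : {ae leb R, forall s, I s -> Bcoef M s <> 0})
    (AB_L2 : in_L2w (leb2 R) (I `*` I) (weight2 w)
               (fun z => Abar M z.1 z.2 / Bcoef M z.2)) :
  symmetric_condition I w M <->
  (Bcoef M = (fun s => Bcoef M (1 - s)) %[ae leb R in I] /\
   exists (alpha : nat * nat -> R) (S : R * R -> R),
     [/\ alpha (0, 1)%N = - alpha (1, 0)%N,
         - alpha (1, 0)%N = - (1 / 2) * inner I w (fun x => x) (horner (P 1%N)),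
         L2w_double_sum I w P
           (fun ij => ~~ odd (ij.1 + ij.2) && (1 < ij.1 + ij.2)%N) alpha S
       & (fun z => Abar M z.1 z.2) =
         (fun z => Bcoef M z.2 *
            (alpha (0, 0)%N + alpha (0, 1)%N * (P 1%N).[z.2]
             + alpha (1, 0)%N * (P 1%N).[z.1] + S z))
         %[ae leb2 R in I `*` I]]).
Proof.
pose H := centered_kernel M; pose m := inner I w (fun x => x) (horner (P 1%N)).
have x12 := poly1E I_sym w_weight P_orthonormal P_sym.
have HE z : H z = Abar M z.1 z.2 / Bcoef M z.2
    - m / 2 * (P 1%N).[z.1] + m / 2 * (P 1%N).[z.2].
  rewrite /H /centered_kernel.
  have -> : z.1 - z.2 = (z.1 - 1 / 2) - (z.2 - 1 / 2) by ring.
  by rewrite !x12 -/m; ring.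
apply: iff_trans.
  exact: symmetric_conditionP I_sym w_weight w_sym C_id Bbar_eq B_neq0.
rewrite -/H; split=> -[Bsym]; last first.
  move=> [alpha [S [a01 a10 Ssum AE]]]; split => //.
  have Ssym : centrally_symmetric I S.
    apply: (L2w_double_sum_symmetric I_sym w_weight w_sym P_orthonormal P_sym _ Ssum).
    by move=> ij /andP[].
  have HS : {ae leb2 R, forall z, (I `*` I) z -> H z = alpha (0, 0)%N + S z}.
    have := aeI AE (ae_snd B_neq0); apply: aeS => z [Az Bz] Iz.
    have B0 : Bcoef M z.2 != 0 by apply/eqP/Bz; case: Iz.
    rewrite HE Az// a01.
    have -> : alpha (1, 0)%N = m / 2 by move: a10; rewrite -/m; lra.
    by field.
  have HSm := ae_measure_preserving mirror2_measure_preserving HS.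
  have := aeI (aeI HS HSm) Ssym; apply: aeS => z [[Hz Hmz] Sz] Iz.
  rewrite /= Hz// Hmz ?Sz//.
  by case: Iz => ? ?; split; exact/(symmetric_domainP _ I_sym).
move=> Hsym.
have L2H : in_L2w (leb2 R) (I `*` I) (weight2 w) H.
  have := in_L2w_add_poly1 I_sym w_weight P_orthonormal (m / 2) (m / 2) AB_L2.
  by congr in_L2w; apply/funext => z; rewrite HE.
have [a Hsum] := symmetric_kernel_expansion I_sym w_weight w_sym P_orthonormal
  P_complete P_sym L2H Hsym.
split => //.
pose S z := H z - a.
(* Outside the index set of the sum the coefficients are free: there they carry
   the constant and the two terms coming from (tau - sigma) / 2. *)
exists (fun ij => if ij == (0, 0)%N then a else if ij == (1, 0)%N then m / 2
  else if ij == (0, 1)%N then - (m / 2) else kernel_coef I w P S ij), S.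
split => //=.
- by rewrite -/m; ring.
- by apply: Hsum => -[[|[|i]] [|[|j]]].
have := ae_snd B_neq0; apply: aeS => z Bz Iz.
have B0 : Bcoef M z.2 != 0 by apply/eqP/Bz; case: Iz.
by rewrite /S HE; field.
Qed.
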